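(* Let $\epsilon>0$ be a parameter and $\tau>0$ a constant. There is a deterministic CONGEST algorithm that, on an $n$-node graph with arboricity $\alpha$, maximum degree $\Delta$ and nonnegative node weights, computes a $\Delta(1+\epsilon)$-approximation for MWIS in $O(\alpha^{\tau}\log n\log(1/\epsilon))$ rounds.
   Context: The arboricity $\alpha$ of a graph is the smallest integer such that its edge set can be partitioned into $\alpha$ forests; $\Delta$ is the maximum node degree. MWIS: given weights $w:V\to\mathbb{R}_{\geq0}$, $OPT(G)$ is the maximum of $w(I)=\sum_{v\in I}w(v)$ over independent sets $I$; an independent set $X$ is a $q$-approximation if $q\cdot w(X)\geq OPT(G)$. CONGEST model: synchronous rounds on the network graph, unique $O(\log n)$-bit identifiers, $O(\log n)$-bit messages per edge per round; weights representable with $O(\log n)$ bits. Standing assumption: every node knows the value of $\alpha$.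
   Formalization: The graph is assumed to have at least one edge (for Δ=0 a Δ(1+ε)-approximation is impossible once a weight is positive), and log(1/ε) in the round bound is read as max(1, ln(1/ε)), since it is zero or negative for ε≥1. *)

(* Defs.v *)
From mathcomp Require Import all_boot all_order all_algebra.
From mathcomp Require Import boolp reals exp.

Set Implicit Arguments.
Unset Strict Implicit.
Unset Printing Implicit Defensive.

Import Order.TTheory GRing.Theory Num.Theory.
Local Open Scope ring_scope.

Record sgraph := SGraph {
  vertex :> finType;
  adj : rel vertex;
  adj_sym : symmetric adj;
  adj_irr : irreflexive adj }.

Section Graph.
Variable G : sgraph.

Definition degree (v : G) : nat := #|[set u | adj v u]|.

Definition maxdeg : nat := \max_(v : G) degree v.

Definition edges : {set {set G}} :=
  [set [set p.1; p.2] | p in [set p : G * G | adj p.1 p.2]].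

(* A simple cycle is a duplicate-free closed walk on at least 3 vertices; the
   bound excludes walking back and forth along a single edge. *)
Definition forest (F : {set {set G}}) : Prop :=
  forall c : seq G, (2 < size c)%N ->
    ~ ucycle [rel x y | [set x; y] \in F] c.

(* [partition] forbids empty blocks, so at most [k] blocks amounts to
   [k] possibly empty forests. *)
Definition forest_partitionable (k : nat) : Prop :=
  exists P : {set {set {set G}}},
    [/\ partition P edges, forall F, F \in P -> forest F & (#|P| <= k)%N].

Lemma forest1 (x y : G) : forest [set [set x; y]].
Proof.
move=> [|a [|b [|c s]]] //= _ /andP[/and3P[ab bc _] /and3P[abN bN _]].
move: ab bc => /set1P ab /set1P bc.
move: abN; rewrite !inE !negb_or => /and3P[_ /negP ac _].
move: bN; rewrite inE negb_or => /andP[/negP nbc _].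
have : c \in [set a; b] by rewrite ab -bc !inE eqxx orbT.
by rewrite !inE => /orP[/eqP ca|/eqP cb]; [apply: ac|apply: nbc];
  rewrite ?ca ?cb.
Qed.

Lemma forest_partitionable_ex : exists k, `[< forest_partitionable k >].
Proof.
exists #|[set [set f] | f in edges]|; apply/asboolP.
exists [set [set f] | f in edges]; split => //.
- apply/and3P; split.
  + apply/eqP/setP => f; apply/bigcupP/idP.
      by case=> _ /imsetP[g gE ->] /set1P ->.
    by move=> fE; exists [set f]; [exact: imset_f | exact: set11].
  + apply/trivIsetP => _ _ /imsetP[f _ ->] /imsetP[g _ ->] fg.
    rewrite disjoints1 inE; apply: contraNN fg => /eqP -> //.
  + apply/imsetP => -[f _ /setP/(_ f)].
    by rewrite !inE eqxx.
- by move=> _ /imsetP[_ /imsetP[p _ ->] ->]; exact: forest1.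
Qed.

Definition arboricity : nat := ex_minn forest_partitionable_ex.

Definition independent (I : {set G}) : bool :=
  [forall u in I, forall v in I, ~~ adj u v].

Section Weights.
Variables (R : realType) (w : G -> R).

Definition weight (I : {set G}) : R := \sum_(v in I) w v.

(* The default 0 is harmless: it is the weight of the independent set [set0]. *)
Definition OPT : R :=
  \big[Num.max/0]_(I : {set G} | independent I) weight I.

Definition approximation (q : R) (X : {set G}) : Prop :=
  independent X /\ OPT <= q * weight X.

End Weights.

(* The neighbours of [v] are reached through ports [0, 1, ..., degree v - 1],
   numbered arbitrarily; nothing relates the two port numbers of an edge. *)
Record network := Network {
  ports : G -> seq G;
  ports_uniq : forall v, uniq (ports v);
  mem_ports : forall v u, (u \in ports v) = adj v u;
  ident : G -> nat;
  ident_inj : injective ident }.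

End Graph.

(* Everything a node knows before the first round. *)
Record local_input (R : realType) := LocalInput {
  in_size : nat;
  in_arboricity : nat;
  in_ident : nat;
  in_degree : nat;
  in_weight : R }.

(* Deterministic synchronous message passing with unrestricted local
   computation.  Messages are bit strings ([::] means silence); [send s p] is
   the message for port [p], and [recv] gets the incoming messages in port
   order.  A node halts as soon as [output] is [Some _]. *)
Record algorithm (I O : Type) := Algorithm {
  state : Type;
  init : I -> state;
  send : state -> nat -> seq bool;
  recv : state -> seq (seq bool) -> state;
  output : state -> option O }.

Section Execution.
Variables (G : sgraph) (N : network G) (I O : Type) (A : algorithm I O).

Definition message (s : G -> state A) (u v : G) : seq bool :=
  if output (s u) is Some _ then [::] else send (s u) (index v (ports N u)).

Definition round (s : G -> state A) (v : G) : state A :=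
  if output (s v) is Some _ then s v
  else recv (s v) [seq message s u v | u <- ports N v].

Definition run (x : G -> I) (t : nat) : G -> state A :=
  iter t round (fun v => init A (x v)).

Definition bandwidth_le (x : G -> I) (b : nat) : Prop :=
  forall (t : nat) (u v : G), adj u v -> (size (message (run x t) u v) <= b)%N.

Definition outputs_after (x : G -> I) (T : nat) (f : G -> O) : Prop :=
  forall v, output (run x T v) = Some (f v).

End Execution.

Definition congest_input (R : realType) (G : sgraph) (N : network G)
    (w : G -> R) (v : G) : local_input R :=
  LocalInput #|G| (arboricity G) (ident N v) (degree v) (w v).

Definition log_bits (c n : nat) : nat := (c * up_log 2 n)%N.

(* Binary fixed-point number with [b] bits on each side of the point. *)
Definition fixed_point (R : realType) (b : nat) (x : R) : Prop :=
  x * 2 ^+ b \is a Num.int /\ `|x| < 2 ^+ b.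

(* Main.v *)
(** The algorithm is a local-ratio scheme.  In each phase an independent set U
   with w(U) >= W / (K D) is chosen, where W is the total remaining weight, D
   the maximum degree and K a constant; the weight of every u in U is then
   subtracted from u and its neighbours, and at the end the phases are unwound
   greedily in reverse order.  The selected weights sum to at most the weight of
   the result, and D times this sum approaches the optimum geometrically, the
   gap shrinking by 1 - 1/K per phase; hence O(log(1/eps)) phases suffice.

   To find U, fix a constant s >= 6/tau and the least p with
   p^s >= 2^(s+1) alpha.  Starting from all nodes, s stages each keep a node
   with probability 1/p.  As the edge weights min(w_u, w_v) sum to at most
   alpha W (charge each forest edge to a child), a sample of density p^-s has
   expected weight W / p^s and edge weight at most half of that; discarding the
   smaller endpoint of each remaining edge leaves U.  A stage is derandomized by
   conditional expectations along a colouring whose monochromatic edges carry a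
   fraction at most p^-2 of the edge weight.  Two defective Linial steps turn the
   identifiers into such a colouring with O(p^6 log n) colours, and p^6 is
   O(alpha^tau). *)
Require Import Defs.
From mathcomp Require Import all_boot all_order all_algebra all_field.
From mathcomp Require Import zify ring lra.
From mathcomp Require Import boolp reals sequences exp.
Import Order.TTheory GRing.Theory Num.Theory.

Set Implicit Arguments.
Unset Strict Implicit.
Unset Printing Implicit Defensive.

(** * Forests and arboricity *)

Section Leaf.
Variables (T : finType) (e : rel T).
Hypotheses (e_sym : symmetric e) (e_irr : irreflexive e).
Hypothesis acyclic : forall c : seq T, 2 < size c -> ~ ucycle e c.

(** If every vertex of [S] had two neighbours in [S], a path could always grow at its head by a
    neighbour other than the predecessor: that neighbour is new, as otherwise it closes a cycle. A
    path cannot exceed [#|T|] vertices. *)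
Lemma acyclic_leaf (S : {set T}) :
  S != set0 -> exists2 x, x \in S & #|[set y in S | e x y]| <= 1.
Proof.
move=> /set0Pn[x0 x0S].
have [//|noleaf] := pselect (exists2 x, x \in S & #|[set y in S | e x y]| <= 1).
have deg2 x : x \in S -> 1 < #|[set y in S | e x y]|.
  by move=> xS; rewrite ltnNge; apply/negP => d; apply: noleaf; exists x.
suff long n : exists x p, [/\ size p = n, uniq (x :: p), path e x p & x \in S].
  have [x [p [sz up _ _]]] := long #|T|.
  have : size (x :: p) <= #|T| by rewrite -(card_uniqP up) max_card.
  by rewrite /= sz ltnn.
elim: n => [|n [x [p [sz up ep xS]]]]; first by exists x0, [::].
have [y [yS exy yp]] : exists y, [/\ y \in S, e x y & y != head x p].
  have /card_gt1P[y [z [+ + yz]]] := deg2 x xS.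
  rewrite !inE => /andP[yS exy] /andP[zS exz].
  have [yh|] := eqVneq y (head x p); last by exists y.
  by exists z; rewrite -yh eq_sym.
have yx : y != x by apply: contraTneq exy => ->; rewrite e_irr.
have [/splitPr yp'|ynp] := boolP (y \in p); last first.
  exists y, (x :: p); split => //=; first by rewrite sz.
    by rewrite inE (negPf yx) ynp.
  by rewrite e_sym exy.
case: yp' up ep yp {sz} => p1 p2 up ep yp.
have [] := acyclic (c := x :: rcons p1 y).
  by case: p1 yp {up ep} => [|z p1] /=; rewrite ?eqxx // size_rcons.
move: up ep; rewrite -cat_rcons -cat_cons cat_uniq cat_path => /andP[up _] /andP[ep _].
by rewrite /ucycle /cycle up andbT rcons_path ep last_rcons e_sym.
Qed.

(** Peel off leaves: the only edge from a leaf [x] into the remaining set contributes at most [a x]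
    in each of its two directions. *)
Lemma acyclic_sum_minn (a : T -> nat) :
  \sum_x \sum_(y | e x y) minn (a y) (a x) <= 2 * \sum_x a x.
Proof.
suff H n (S : {set T}) : #|S| = n ->
    \sum_(x in S) \sum_(y in S | e x y) minn (a y) (a x) <= 2 * \sum_(x in S) a x.
  have sT (F : T -> nat) : \sum_(x in [set: T]) F x = \sum_x F x.
    by apply: eq_bigl => x; rewrite inE.
  by have := H _ [set: T] erefl; rewrite !sT; under eq_bigr do under eq_bigl do rewrite inE.
elim: n S => [|n IH] S Sn.
  by move/eqP: Sn; rewrite cards_eq0 => /eqP ->; rewrite !big_set0.
have [|x xS leaf] := @acyclic_leaf S; first by rewrite -card_gt0 Sn.
have := IH (S :\ x); rewrite (cardsD1 x) xS in Sn.
move=> /(_ ltac:(lia)) {}IH.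
have le_nbr : \sum_(y in S | e x y) minn (a y) (a x) <= a x.
  apply: leq_trans (_ : \sum_(y in S | e x y) a x <= _).
    by apply: leq_sum => y _; exact: geq_minr.
  rewrite sum_nat_cond_const -[leqRHS]mul1n leq_mul2r.
  by move: leaf; rewrite cardsE => ->; rewrite orbT.
rewrite (big_setD1 x xS) [in leqRHS](big_setD1 x xS) /=.
have -> : \sum_(z in S :\ x) \sum_(y in S | e z y) minn (a y) (a z) =
    \sum_(z in S :\ x | e x z) minn (a z) (a x) +
    \sum_(z in S :\ x) \sum_(y in S :\ x | e z y) minn (a y) (a z).
  rewrite [X in _ = X + _]big_mkcondr -big_split /=.
  apply: eq_bigr => z _; rewrite [LHS]big_mkcondr [X in _ = _ + X]big_mkcondr /=.
  by rewrite (big_setD1 x xS) /= e_sym minnC.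
have : \sum_(z in S :\ x | e x z) minn (a z) (a x) <= a x.
  apply: leq_trans le_nbr; rewrite [leqRHS]big_mkcond [leqLHS]big_mkcond.
  by apply: leq_sum => z _; rewrite !inE; case: (z == x); case: (_ \in _); case: (e x z).
by rewrite mulnDr; lia.
Qed.
End Leaf.

Lemma set2_eq (T : finType) (x y u v : T) :
  [set x; y] = [set u; v] -> x = u /\ y = v \/ x = v /\ y = u.
Proof.
move=> /setP E; have := E x; have := E y; have := E u; have := E v.
rewrite !inE !eqxx !orbT => /pred2P Ev /pred2P Eu.
move=> /esym/pred2P Ey /esym/pred2P Ex.
by case: Ex => Ex; case: Ey => Ey; case: Eu => Eu; case: Ev => Ev;
  (left; split; congruence) || (right; split; congruence).
Qed.

Section Arboricity.
Variable G : sgraph.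

Lemma arboricityP : forest_partitionable G (arboricity G).
Proof. by rewrite /arboricity; case: ex_minnP => m /asboolP. Qed.

Lemma arboricity_leq k : forest_partitionable G k -> arboricity G <= k.
Proof.
by move=> Gk; rewrite /arboricity; case: ex_minnP => m _; apply; apply/asboolP.
Qed.

Lemma edges_pair (x y : G) : ([set x; y] \in edges G) = adj x y.
Proof.
apply/imsetP/idP => [[[u v] /=]|xy]; last by exists (x, y); rewrite ?inE.
by rewrite inE /= => uv /set2_eq[[-> ->]|[-> ->]] //; rewrite adj_sym.
Qed.

Lemma arboricity_gt0 : 0 < maxdeg G -> 0 < arboricity G.
Proof.
have [P [/and3P[/eqP covP _ _] _ cardP]] := arboricityP.
move=> D0; apply: leq_trans cardP; rewrite lt0n cards_eq0.
apply/eqP => P0; move: D0; rewrite lt0n; apply/negP; rewrite negbK.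
rewrite -leqn0; apply/bigmax_leqP => v _; rewrite leqn0 cards_eq0.
apply/eqP/setP => u; rewrite !inE -edges_pair -covP P0.
by rewrite /cover big_set0 inE.
Qed.

(** Every edge lies in a block of an optimal partition, so the forest bound is summed over at most
    [arboricity G] blocks. *)
Lemma arboricity_sum_minn (a : G -> nat) :
  \sum_(v : G) \sum_(u | adj v u) minn (a u) (a v) <= 2 * arboricity G * \sum_v a v.
Proof.
have [P [partP forestP cardP]] := arboricityP.
apply: leq_trans (_ : \sum_(F in P) \sum_(v : G)
    \sum_(u | [set v; u] \in F) minn (a u) (a v) <= _).
  rewrite exchange_big; apply: leq_sum => v _ /=.
  under [leqRHS]eq_bigr do rewrite big_mkcond.
  rewrite exchange_big [leqLHS]big_mkcond; apply: leq_sum => u _ /=.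
  case: ifP => // vu; have := edges_pair v u; rewrite vu -(cover_partition partP).
  by case/bigcupP => F FP vuF; rewrite (bigD1 F) //= vuF leq_addr.
apply: leq_trans (_ : \sum_(F in P) 2 * \sum_v a v <= _).
  apply: leq_sum => F FP; apply: (@acyclic_sum_minn _ [rel x y | [set x; y] \in F]).
  - by move=> x y /=; rewrite setUC.
  - move=> x /=; apply/negP => xF; have := edges_pair x x.
    rewrite -(cover_partition partP) adj_irr => /bigcupP; apply.
    by exists F.
  - exact: forestP.
by rewrite sum_nat_const mulnCA -mulnA leq_mul2l leq_mul2r cardP orbT.
Qed.

Lemma degree_le_maxdeg (v : G) : degree v <= maxdeg G.
Proof. exact: leq_bigmax. Qed.

(* Order the vertices; the i-th class joins every vertex to its i-th smaller
   neighbour.  The largest vertex of a cycle would have two of them. *)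
Lemma arboricity_le_maxdeg : arboricity G <= maxdeg G.
Proof.
pose r (x : G) : nat := enum_rank x.
have r_inj : injective r by move=> x y /val_inj /enum_rank_inj.
pose f (x y : G) := index y (enum [set z | adj x z]).
have fD x y : adj x y -> f x y < maxdeg G.
  move=> xy; apply: leq_trans (degree_le_maxdeg x).
  by rewrite /degree cardE index_mem mem_enum inE.
pose F i := [set [set p.1; p.2] | p in [set p : G * G |
  [&& adj p.1 p.2, r p.2 < r p.1 & f p.1 p.2 == i]]].
have FP i x y : r y < r x -> ([set x; y] \in F i) = adj x y && (f x y == i).
  move=> yx; apply/imsetP/idP => [[[u v] /=]|/andP[xy fi]]; last first.
    by exists (x, y) => //; rewrite inE /= xy yx.
  rewrite inE /= => /and3P[uv vu fi] /set2_eq[[-> ->]|[xv yu]]; first by rewrite uv fi.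
  by move: yx; rewrite xv yu ltnNge ltnW.
have Fsym i (x y : G) : [set x; y] \in F i -> adj x y.
  case/imsetP => p; rewrite inE => /and3P[p12 _ _] E.
  by rewrite -edges_pair E edges_pair.
have F_rank i x y : [set x; y] \in F i -> r x != r y.
  by move=> /Fsym; apply: contraTneq => /r_inj ->; rewrite adj_irr.
(* Some classes [F i] may be empty, and a partition admits no empty block. *)
apply: arboricity_leq; exists ([set F (i : 'I_(maxdeg G)) | i : 'I_(maxdeg G)] :\ set0).
split.
- apply/and3P; split; last by rewrite !inE eqxx.
  + apply/eqP/setP => E; apply/bigcupP/idP => [[_ /setD1P[_ /imsetP[i _ ->]]]|].
      case/imsetP => p; rewrite inE => /and3P[p12 _ _] ->.
      by rewrite edges_pair.
    case/imsetP => -[x y]; rewrite inE /= => xy ->.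
    wlog yx : x y xy / r y < r x => [W|].
      have [yx|xy'|/r_inj e] := ltngtP (r y) (r x); first exact: W.
        by rewrite setUC; apply: W; rewrite // adj_sym.
      by move: xy; rewrite e adj_irr.
    have xyF : [set x; y] \in F (Ordinal (fD x y xy)) by rewrite FP // xy /=.
    exists (F (Ordinal (fD x y xy))) => //.
    rewrite !inE imset_f // andbT; apply/eqP => F0.
    by rewrite F0 inE in xyF.
  + apply/trivIsetP => _ _ /setD1P[_ /imsetP[i _ ->]] /setD1P[_ /imsetP[j _ ->]].
    apply: contraNT => /pred0Pn[E /andP[/= /imsetP[[x y]]]].
    rewrite inE /= => /and3P[xy yx /eqP fi] ->; rewrite FP // xy /= => /eqP fj.
    by rewrite -(_ : i = j) //; apply: val_inj; rewrite /= -fi -fj.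
- move=> _ /setD1P[_ /imsetP[i _ ->]] c c3 /andP[cyc unc].
  have [v vc vmax] : exists2 v, v \in c & forall u, u \in c -> r u <= r v.
    case: c c3 {cyc unc} => // x c _.
    have [v vc vmax] := arg_maxnP (P := [in x :: c]) r (mem_head x c).
    by exists v.
  case: (rot_to vc) => k p rotc.
  move: cyc unc c3; rewrite -(rot_cycle k) -(rot_uniq k) -(size_rot k).
  rewrite rotc; case: p rotc => [|y p] //; case/lastP: p => [|p z] // rotc.
  rewrite /cycle rcons_path last_cons last_rcons -rcons_cons rcons_path.
  move=> /andP[/andP[/= /andP[vy _]] _ zv] /andP[_ /andP[+ _]] _.
  have mem u : u \in [:: v, y & rcons p z] -> r u <= r v.
    by rewrite -rotc mem_rot; exact: vmax.
  have yv : r y < r v by rewrite ltn_neqAle mem ?inE ?eqxx ?orbT // eq_sym (F_rank _ _ _ vy).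
  have {}zv : [set v; z] \in F i by rewrite setUC.
  have zv' : r z < r v.
    by rewrite ltn_neqAle mem ?inE ?mem_rcons ?inE ?eqxx ?orbT // eq_sym (F_rank _ _ _ zv).
  move: vy zv; rewrite !FP // => /andP[vy /eqP fy] /andP[vz /eqP fz].
  have yz : y = z.
    have mE u : adj v u -> u \in enum [set z | adj v z] by rewrite mem_enum inE.
    by apply: (index_inj v (mE _ vy) (mE _ vz)); rewrite -/(f v y) fy -fz.
  by rewrite yz mem_rcons mem_head.
- rewrite (leq_trans (subset_leq_card (subsetDl _ _))) //.
  by rewrite (leq_trans (leq_imset_card _ _)) // card_ord.
Qed.
End Arboricity.

(** * Messages and hashing *)

Fixpoint encode (b m : nat) : seq bool :=
  if b is b'.+1 then odd m :: encode b' m./2 else [::].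

Definition decode (s : seq bool) : nat := foldr (fun (x : bool) n => x + n.*2) 0 s.

Lemma size_encode b m : size (encode b m) = b.
Proof. by elim: b m => //= b IH m; rewrite IH. Qed.

Lemma encodeK b m : m < 2 ^ b -> decode (encode b m) = m.
Proof.
elim: b m => [|b IH] m /=; first by rewrite expn0; lia.
move=> mb; rewrite IH; first by rewrite odd_double_half.
by move: mb; rewrite expnS; lia.
Qed.

(* An element c of [2^k] is read as the polynomial over GF(2^j) whose
   coefficients are the bits of c, and hashed by evaluation; two distinct
   polynomials of degree less than k agree on fewer than k points. *)
Lemma hash_family (j k : nat) :
  exists h : nat -> nat -> nat, 0 < j -> (forall c x, x < 2 ^ j -> h c x < 2 ^ j) /\
    forall c c', c < 2 ^ k -> c' < 2 ^ k -> c != c' ->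
      count (fun x => h c x == h c' x) (iota 0 (2 ^ j)) <= k.
Proof.
(* The condition on [j] sits inside the existential, so that a family can be chosen for every [j];
   at [j = 0] nothing is required of it. *)
have [j0|] := ltnP 0 j; last by exists (fun _ _ => 0); case: (j).
have [F _ Fc] := PrimePowerField (isT : prime 2) j0.
pose P c : {poly F} := Poly [seq (nat_of_bool b)%:R%R | b <- encode k c].
exists (fun c x => index (P c).[nth 0%R (enum F) x]%R (enum F)) => _; split.
  by move=> c x _; rewrite -Fc cardE index_mem mem_enum.
move=> c c' cb c'b cc'.
rewrite -Fc cardE.
have -> : count (fun x => index (P c).[nth 0%R (enum F) x]%R (enum F)
      == index (P c').[nth 0%R (enum F) x]%R (enum F)) (iota 0 (size (enum F)))
   = count (root (P c - P c')) (enum F).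
  rewrite -[in RHS](mkseq_nth 0%R (enum F)) /mkseq count_map; apply: eq_count => x /=.
  rewrite rootE !hornerE subr_eq0; apply/eqP/eqP => [eqi|-> //].
  have mE (z : F) : z \in enum F by rewrite mem_enum.
  by rewrite -[LHS](nth_index 0%R (mE _)) eqi nth_index.
have Pn0 : (P c - P c' != 0)%R.
  rewrite subr_eq0; apply: contra cc' => /eqP Pcc'.
  rewrite -(encodeK cb) -(encodeK c'b); apply/eqP; congr decode.
  apply: (@eq_from_nth _ false); rewrite !size_encode // => i ik.
  have /polyP/(_ i) := Pcc'; rewrite !coef_Poly !(nth_map false) ?size_encode //.
  by case: nth; case: nth => // /eqP; rewrite ?oner_eq0 // eq_sym oner_eq0.
rewrite -size_filter.
apply: leq_trans (_ : size (P c - P c')%R <= _); last first.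
  apply: leq_trans (size_polyD _ _) _; rewrite size_polyN geq_max.
  by rewrite !(leq_trans (size_Poly _)) // size_map size_encode.
apply: ltnW; apply: max_poly_roots => //; first exact: filter_all.
by rewrite filter_uniq // enum_uniq.
Qed.

(* During a stage, [lab] is p times the probability of keeping the node: 1 as
   long as it is undecided, then p or 0.  During the unwinding, [lab] is 1 on
   the solution and 0 elsewhere.  [act] is the weight of the node in the current
   sample (0 outside), and [hist] records, last phase first, the phases that
   selected the node. *)
Record node := Node {
  wt : nat; act : nat; color : nat; lab : nat; idn : nat; hist : seq bool }.

Definition msg := (nat * nat * nat)%type.

Definition view (x : node) : msg := (act x, color x, lab x).

Definition pack (b : nat) (x : node) : seq bool :=
  encode b (act x) ++ encode b (color x) ++ encode b (lab x).

Definition unpack (b : nat) (s : seq bool) : msg :=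
  (decode (take b s), decode (take b (drop b s)), decode (drop b (drop b s))).

Definition fits (b : nat) (x : node) :=
  [/\ act x < 2 ^ b, color x < 2 ^ b & lab x < 2 ^ b].

Lemma size_pack b x : size (pack b x) = 3 * b.
Proof. by rewrite !size_cat !size_encode; lia. Qed.

Lemma packK b x : fits b x -> unpack b (pack b x) = view x.
Proof.
move=> [ha hc hl]; rewrite /unpack /pack.
by rewrite !(take_size_cat, drop_size_cat) ?size_encode // !encodeK.
Qed.

Definition rule := node -> seq msg -> node.

Section Exec.
Variables (G : sgraph) (N : network G) (b : nat).

(** Encoding and decoding stay in the semantics, so that it agrees with the compiled algorithm
    unconditionally; [stepE] removes them once all fields fit. *)
Definition step (r : rule) (s : G -> node) (v : G) : node :=
  r (s v) [seq unpack b (pack b (s u)) | u <- ports N v].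

Definition exec (P : seq rule) (s : G -> node) : G -> node :=
  foldl (fun s r => step r s) s P.

Lemma exec_cat P P' s : exec (P ++ P') s = exec P' (exec P s).
Proof. exact: foldl_cat. Qed.

Lemma stepE r s v : (forall u, fits b (s u)) ->
  step r s v = r (s v) [seq view (s u) | u <- ports N v].
Proof. by move=> fit; congr r; apply: eq_map => u; exact: packK. Qed.

Lemma sum_view (P : pred msg) (F : msg -> nat) (s : G -> node) v :
  \sum_(m <- [seq view (s u) | u <- ports N v] | P m) F m =
  \sum_(u | adj v u && P (view (s u))) F (view (s u)).
Proof.
rewrite big_map -big_filter big_uniq ?filter_uniq ?ports_uniq //.
by apply: eq_bigl => u; rewrite mem_filter mem_ports andbC.
Qed.

Lemma has_view (P : pred msg) (s : G -> node) v :
  has P [seq view (s u) | u <- ports N v] = [exists u, adj v u && P (view (s u))].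
Proof.
rewrite has_map; apply/hasP/existsP => [[u uv Pu]|[u /andP[uv Pu]]].
  by exists u; rewrite -(mem_ports N) uv.
by exists u; rewrite ?mem_ports.
Qed.
End Exec.

(** * The rules of the algorithm *)

Definition hash (j k : nat) : nat -> nat -> nat := sval (cid (hash_family j k)).

Lemma hash_lt j k c x : 0 < j -> x < 2 ^ j -> hash j k c x < 2 ^ j.
Proof. by rewrite /hash; case: cid => h hP /= /hP[+ _]; apply. Qed.

Lemma hash_collision j k c c' : 0 < j -> c < 2 ^ k -> c' < 2 ^ k -> c != c' ->
  count (fun x => hash j k c x == hash j k c' x) (iota 0 (2 ^ j)) <= k.
Proof. by rewrite /hash; case: cid => h hP /= /hP[_]; apply. Qed.

Section Rules.
Variables p L : nat.

(** With [2 ^ hbits k >= 2 p^2 k] evaluation points, two distinct colours below [2 ^ k] collide on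
    at most a fraction [1 / (2 p^2)] of them. *)
Definition hbits (k : nat) := up_log 2 (2 * p ^ 2 * k).

Definition conflict (h : nat -> nat -> nat) (a c : nat) (ms : seq msg) (x : nat) :=
  \sum_(m <- ms | (m.1.2 != c) && (h m.1.2 x == h c x)) minn m.1.1 a.

Definition point (k a c : nat) (ms : seq msg) : nat :=
  let j := hbits k in
  find (fun x => 2 * p ^ 2 * conflict (hash j k) a c ms x <= \sum_(m <- ms) minn m.1.1 a)
       (iota 0 (2 ^ j)).

(** The pair of evaluation point and hash value, written in base [2 ^ hbits k]: equal new colours
    mean equal points and equal values. *)
Definition recolor (k a c : nat) (ms : seq msg) : nat :=
  let x := point k a c ms in x * 2 ^ hbits k + hash (hbits k) k c x.

Definition r_recolor (k : nat) : rule := fun x ms =>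
  Node (wt x) (act x) (recolor k (act x) (color x) ms) 1 (idn x) (hist x).

(** The nodes of colour [i] decide simultaneously. The test is the sign of half the derivative of
    [gain] in the node's own label. *)
Definition r_turn (k i : nat) : rule := fun x ms =>
  if color x != i then x else
  Node (wt x) (act x) (color x)
    (if 2 ^ k * \sum_(m <- ms | m.1.2 != i) m.2 * minn m.1.1 (act x) <= p ^ k.+1 * act x
     then p else 0)
    (idn x) (hist x).

(** The colour returns to the identifier, so that the next stage again starts from a proper
    colouring. *)
Definition r_keep : rule := fun x _ =>
  Node (wt x) (if lab x == 0 then 0 else act x) (idn x) (lab x) (idn x) (hist x).

Definition stage (k : nat) : seq rule :=
  [:: r_recolor L; r_recolor (2 * hbits L)] ++
  [seq r_turn k i | i <- iota 0 (2 ^ (2 * hbits (2 * hbits L)))] ++ [:: r_keep].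

(** The index [k] counts the stages still to come, on which the factors [2 ^ k] and [p ^ k.+1] in
    [r_turn] depend. *)
Fixpoint stages (s : nat) : seq rule :=
  if s is k.+1 then stage k ++ stages k else [::].

Definition r_start : rule := fun x _ =>
  Node (wt x) (wt x) (idn x) 0 (idn x) (hist x).

Definition r_select : rule := fun x ms =>
  Node (wt x)
    (if has (fun m => (act x < m.1.1) || (act x == m.1.1) && (color x < m.1.2)) ms
     then 0 else act x)
    (color x) (lab x) (idn x) (hist x).

(** Truncated subtraction replaces a weight that would become negative by 0. *)
Definition r_reduce : rule := fun x ms =>
  Node (wt x - (act x + \sum_(m <- ms) m.1.1)) (act x) (color x) (lab x) (idn x)
    ((0 < act x) :: hist x).

Definition phase (s : nat) : seq rule :=
  r_start :: stages s ++ [:: r_select; r_reduce].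

Definition r_out : rule := fun x _ =>
  Node (wt x) (act x) (color x) 0 (idn x) (hist x).

Definition r_back : rule := fun x ms =>
  Node (wt x) (act x) (color x)
    ((lab x == 1) || head false (hist x) && ~~ has (fun m => m.2 == 1) ms)
    (idn x) (behead (hist x)).

(** Each phase is nested around the remaining ones, so the calls of [r_back] treat the phases in
    reverse order. *)
Fixpoint program (s M : nat) : seq rule :=
  if M is M'.+1 then phase s ++ program s M' ++ [:: r_back] else [:: r_out].

End Rules.

Lemma hbits_gt0 p k : 1 < p -> 0 < k -> 0 < hbits p k.
Proof.
move=> p1 k0; rewrite up_log_gt0; apply: leq_trans (_ : 2 * 1 ^ 2 * 1 <= _) => //.
by rewrite ?leq_mul ?leq_exp2r // ltnW.
Qed.

(** * One sampling stage *)

Section Coloring.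
Variables (G : sgraph) (N : network G) (b p : nat).
Hypothesis p1 : 1 < p.

Definition energy (a : G -> nat) := \sum_(v : G) \sum_(u | adj v u) minn (a u) (a v).

Definition mono (a c : G -> nat) :=
  \sum_(v : G) \sum_(u | adj v u && (c u == c v)) minn (a u) (a v).

(* Averaging over the points: two nodes of distinct colours collide on at most
   k of the 2^(hbits k) >= 2 p^2 k points. *)
Lemma pointP k (a c : nat) (ms : seq msg) :
  0 < k -> c < 2 ^ k -> (forall m, m \in ms -> m.1.2 < 2 ^ k) ->
  let x := point p k a c ms in x < 2 ^ hbits p k /\
  2 * p ^ 2 * conflict (hash (hbits p k) k) a c ms x <= \sum_(m <- ms) minn m.1.1 a.
Proof.
move=> k0 ck msk /=; set j := hbits p k; set h := hash j k.
have j0 : 0 < j := hbits_gt0 p1 k0.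
rewrite /point -/j -/h; set P := fun x => _; set S := \sum_(m <- ms) _.
have hP : has P (iota 0 (2 ^ j)).
  apply: contraT => /hasPn nP.
  have : \sum_(x <- iota 0 (2 ^ j)) S.+1 <=
      \sum_(x <- iota 0 (2 ^ j)) 2 * p ^ 2 * conflict h a c ms x.
    rewrite !big_seq; apply: leq_sum => x /nP; rewrite /P -ltnNge; exact.
  rewrite -big_distrr /= big_const_seq count_predT size_iota iter_addn_0.
  have : \sum_(x <- iota 0 (2 ^ j)) conflict h a c ms x <= k * S.
    under eq_bigr do rewrite /conflict big_mkcond.
    rewrite exchange_big /= big_distrr /= !big_seq; apply: leq_sum => m mms.
    have [->|mc] := eqVneq m.1.2 c; first by rewrite big1.
    rewrite /= -big_mkcond big_const_seq iter_addn_0 mulnC leq_mul2r.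
    by rewrite hash_collision ?orbT ?msk.
  have : 2 * p ^ 2 * k <= 2 ^ j by apply: up_logP.
  have : 0 < 2 ^ j by rewrite expn_gt0.
  set X := 2 ^ j; set Y := \sum_(x <- _) _; set q := p ^ 2 => X0 qX YS.
  suff : 2 * q * Y <= X * S by nia.
  apply: leq_trans (_ : 2 * q * (k * S) <= _); first by rewrite leq_mul2l YS orbT.
  by rewrite mulnA leq_mul2r qX orbT.
have := nth_find 0 hP; have := hP; rewrite has_find size_iota => fx.
by rewrite nth_iota // add0n.
Qed.

(** An edge that becomes monochromatic has both ends at the same point with the same hash value, so
    it is counted in the conflict that the choice of point keeps below a [1 / (2 p^2)] share. *)
Lemma recolorP k (s : G -> node) :
  (forall v, fits b (s v)) -> 0 < k -> (forall v, color (s v) < 2 ^ k) ->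
  let s' := step N b (r_recolor p k) s in
  (forall v, color (s' v) < 2 ^ (2 * hbits p k)) /\
  2 * p ^ 2 * mono (act \o s) (color \o s') <=
  2 * p ^ 2 * mono (act \o s) (color \o s) + energy (act \o s).
Proof.
move=> fit k0 sk s'; set j := hbits p k.
have j0 : 0 < j := hbits_gt0 p1 k0.
pose ms v := [seq view (s u) | u <- ports N v].
pose x v := point p k (act (s v)) (color (s v)) (ms v).
have xP v := @pointP k (act (s v)) (color (s v)) (ms v) k0 (sk v).
have {}xP v : x v < 2 ^ j /\ 2 * p ^ 2 * \sum_(u | adj v u &&
     ((color (s u) != color (s v)) && (hash j k (color (s u)) (x v) == hash j k (color (s v)) (x v))))
     minn (act (s u)) (act (s v)) <= \sum_(u | adj v u) minn (act (s u)) (act (s v)).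
  have [|xj] := xP v; first by move=> _ /mapP[u _ ->]; exact: sk.
  rewrite /conflict !sum_view /=; under [leqRHS]eq_bigl do rewrite andbT.
  by [].
have cE v : color (s' v) = x v * 2 ^ j + hash j k (color (s v)) (x v).
  by rewrite /s' stepE.
have hlt v c : hash j k c (x v) < 2 ^ j by apply: hash_lt => //; case: (xP v).
split=> [v|].
  rewrite cE mul2n -addnn expnD; have [xj _] := xP v.
  apply: leq_trans (_ : (x v).+1 * 2 ^ j <= _); first by rewrite mulSn addnC ltn_add2r.
  by rewrite leq_mul2r xj orbT.
rewrite !big_distrr -big_split; apply: leq_sum => v _.
have [_ xv] := xP v; apply: leq_trans (leq_add (leqnn _) xv).
rewrite -mulnDr leq_mul2l; apply/orP; right.
rewrite !big_mkcondr -big_split [leqLHS]big_mkcond [leqRHS]big_mkcond.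
apply: leq_sum => u _.
case: (adj v u) => //; rewrite [(color \o s') u]cE [(color \o s') v]cE /=.
case: eqVneq => [|_]; rewrite ?leq0n //.
have [->|_] := eqVneq (color (s u)) (color (s v)) => /=; first by rewrite leq_addr.
move=> E; have xuv : x u = x v.
  by have := congr1 (divn^~ (2 ^ j)) E; rewrite !divnMDl ?expn_gt0 // !divn_small // !addn0.
by move: E; rewrite xuv => /addnI ->; rewrite eqxx.
Qed.

(** As no two interacting variables move together, the form changes by exactly its linear part,
    twice the sum of the products [d v * (A v - ...)]. *)
Lemma quadratic_step (A : G -> int) (q : G -> G -> int) (y d : G -> int) :
  (forall u v, q u v = q v u) -> (forall u v, q u v * d u * d v = 0)%R ->
  (forall v, 0 <= d v * (A v - \sum_u q v u * y u))%R ->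
  (2 * \sum_v A v * y v - \sum_v \sum_u q v u * y v * y u <=
   2 * \sum_v A v * (y v + d v) - \sum_v \sum_u q v u * (y v + d v) * (y u + d u))%R.
Proof.
move=> q_sym qd dA; rewrite -subr_ge0.
set lhs := (X in (0 <= X)%R).
suff -> : lhs = (2 * \sum_v d v * (A v - \sum_u q v u * y u))%R.
  by rewrite mulr_ge0 // sumr_ge0.
rewrite /lhs; under [X in (_ - X - _)%R]eq_bigr => v _.
  under eq_bigr => u _.
    rewrite (_ : _ * _ = q v u * y v * y u + (d v * (q v u * y u) +
      d u * (q u v * y v)) + q v u * d v * d u)%R; last by rewrite (q_sym u v); ring.
    rewrite qd addr0; over.
  rewrite big_split /= big_split /= -mulr_sumr; over.
rewrite !big_split /= [X in (_ + (_ + X))%R]exchange_big /=.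
under [X in (_ + (_ + X))%R]eq_bigr do rewrite -mulr_sumr.
under [in RHS]eq_bigr do rewrite mulrBr.
under [X in (2 * X - _ - _)%R]eq_bigr do rewrite mulrDr.
rewrite big_split sumrB /=.
under [X in (_ = 2 * (X - _))%R]eq_bigr do rewrite mulrC.
by ring.
Qed.
End Coloring.

Definition relab (x : node) (l : nat) : node :=
  Node (wt x) (act x) (color x) l (idn x) (hist x).

Section Stage.
Variables (G : sgraph) (N : network G) (b p L : nat).
Hypotheses (p1 : 1 < p) (pb : p < 2 ^ b) (L0 : 0 < L) (Lb : L <= b).
Hypotheses (L1b : 2 * hbits p L <= b) (L2b : 2 * hbits p (2 * hbits p L) <= b).

(* Up to a factor 2 p^(k+2), the expectation of the weight minus (2/p)^k times
   the non-monochromatic edge weight of the sample that keeps v with probability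
   l v / p; edges are counted in both directions. *)
Definition gain (k : nat) (a c l : G -> nat) : int :=
  (2 * \sum_v (p ^ k.+1 * a v)%:Z * (l v)%:Z -
   \sum_v \sum_u (if adj v u && (c u != c v) then (2 ^ k * minn (a u) (a v))%:Z else 0)
     * (l v)%:Z * (l u)%:Z)%R.

(** Conditional expectations, one colour class per round: nodes moving together share a colour and
    hence do not interact in [gain], so [quadratic_step] applies. *)
Lemma turnsP k (s : G -> node) n :
  (forall v, fits b (s v)) -> (forall v, lab (s v) = 1) ->
  exists l : G -> nat,
    [/\ forall v, exec N b [seq r_turn p k i | i <- iota 0 n] s v = relab (s v) (l v),
        forall v, (color (s v) < n -> l v = 0 \/ l v = p) /\ (n <= color (s v) -> l v = 1)
      & (gain k (act \o s) (color \o s) (fun=> 1%N) <= gain k (act \o s) (color \o s) l)%R].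
Proof.
move=> fit lab1; elim: n => [|n [l [tE lP gle]]].
  by exists (fun=> 1%N); split=> // v /=; case: (s v) (lab1 v) => ? ? ? ? ? ? /= ->.
rewrite -addn1 iotaD map_cat exec_cat /= add0n.
set t := exec _ _ _ _ in tE *.
have fitt v : fits b (t v).
  rewrite tE; have [ha hc _] := fit v; split=> //=.
  have [l0 l1] := lP v; have b1 : 1 < 2 ^ b := ltn_trans p1 pb.
  by have [/l0[] ->|/l1 ->] // := ltnP (color (s v)) n; rewrite expn_gt0.
pose S v := 2 ^ k * \sum_(u | adj v u && (color (s u) != n)) l u * minn (act (s u)) (act (s v)).
pose l' v := if color (s v) != n then l v else
  if S v <= p ^ k.+1 * act (s v) then p else 0.
have stE v : step N b (r_turn p k n) t v = relab (s v) (l' v).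
  rewrite stepE // /r_turn sum_view tE /= /l' /S; case: eqP => //= _.
  by congr Node; under eq_bigr do rewrite tE; under eq_bigl do rewrite tE.
exists l'; split=> // [v|].
  have [l0 l1] := lP v; rewrite /l' addn1 ltnS leq_eqVlt.
  case: eqVneq => [->|cn] /=; first by rewrite ltnn; split=> // _; case: ifP; auto.
  by split=> // /ltnW.
apply: le_trans gle _.
have := @quadratic_step G (fun v => Posz (p ^ k.+1 * act (s v)))
  (fun v u => if adj v u && (color (s u) != color (s v))
              then Posz (2 ^ k * minn (act (s u)) (act (s v))) else 0)%R
  (fun v => Posz (l v)) (fun v => (l' v)%:Z - (l v)%:Z)%R.
rewrite /gain /=.
under [X in _ -> _ -> _ -> (_ <= 2 * X - _)%R]eq_bigr do rewrite subrKC.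
under [X in _ -> _ -> _ -> (_ <= _ - X)%R]eq_bigr do
  under eq_bigr do rewrite !subrKC.
apply=> [u v|u v|v].
- by rewrite adj_sym eq_sym minnC.
- case: ifP => [/andP[_ uv]|_]; last by rewrite !mul0r.
  rewrite /l'; have [un|] := eqVneq (color (s u)) n; last by rewrite subrr mulr0 mul0r.
  by rewrite -un uv subrr mulr0.
- rewrite /l'; have [vn|] := eqVneq (color (s v)) n; last by rewrite subrr mul0r.
  have [_ /(_ _)] := lP v; rewrite vn leqnn => /(_ isT) ->.
  have -> : (\sum_u (if adj v u && (color (s u) != n)
      then (2 ^ k * minn (act (s u)) (act (s v)))%:Z else 0) * (l u)%:Z = (S v)%:Z)%R.
    rewrite /S big_distrr [in RHS]big_mkcond -[RHS]natz natr_sum /=.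
    apply: eq_bigr => u _; case: ifP => _; rewrite ?mul0r //.
    by rewrite natz !PoszM; ring.
  (* The label moves from 1 up to [p] when the coefficient is nonnegative and down to 0 otherwise,
     so both factors have the same sign. *)
  case: leqP => Sv.
    by apply: mulr_ge0; rewrite subr_ge0 lez_nat // ltnW.
  by apply: mulr_le0; rewrite subr_le0 lez_nat // ltnW.
Qed.

(** Twice the weight minus the energy expected after [k] more stages, scaled by [p ^ (2 * k)]. The
    factor [2 ^ k] lets each stage double the surviving energy, which pays for monochromatic
    edges. *)
Definition potential (k : nat) (a : G -> nat) : int :=
  ((2 * p ^ k * \sum_v a v)%:Z - (2 ^ k * energy a)%:Z)%R.

Lemma gainE k (a c l : G -> nat) :
  (gain k a c l = (2 * p ^ k.+1 * \sum_v a v * l v)%:Z - (2 ^ k *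
   \sum_(v : G) \sum_(u | adj v u && (c u != c v)) l u * l v * minn (a u) (a v))%:Z)%R.
Proof.
rewrite /gain; congr (_ - _)%R.
  rewrite -mulnA PoszM [in RHS]big_distrr /= -[X in _ = (_ * X)%R]natz natr_sum.
  by congr (_ * _)%R; apply: eq_bigr => v _; rewrite natz !PoszM; ring.
rewrite big_distrr -[RHS]natz natr_sum; apply: eq_bigr => v _ /=.
rewrite big_distrr [in RHS]big_mkcond natr_sum; apply: eq_bigr => u _ /=.
by case: ifP => _; rewrite ?mul0r // natz !PoszM; ring.
Qed.

Lemma energy_mono (a c : G -> nat) :
  energy a = \sum_(v : G) \sum_(u | adj v u && (c u != c v)) minn (a u) (a v) + mono a c.
Proof.
rewrite -big_split; apply: eq_bigr => v _ /=.
rewrite !(big_mkcondr _ _ (adj v)) -big_split /=.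
by apply: eq_bigr => u _; case: eqP => _; rewrite ?addn0.
Qed.

Lemma gain1 k (a c : G -> nat) :
  gain k a c (fun=> 1%N) =
  ((2 * p ^ k.+1 * \sum_v a v)%:Z - (2 ^ k * energy a)%:Z + (2 ^ k * mono a c)%:Z)%R.
Proof.
rewrite gainE (energy_mono a c) mulnDr [in RHS]PoszD opprD addrA subrK.
congr (Posz (_ * _) - Posz (_ * _))%R; first by apply: eq_bigr => v _; rewrite muln1.
by apply: eq_bigr => v _; apply: eq_bigr => u _; rewrite !mul1n.
Qed.

Lemma gainp k (a c l : G -> nat) : (forall v, l v = 0 \/ l v = p) ->
  let a' v := if l v == 0 then 0 else a v in
  (gain k a c l = (p ^ 2)%:Z * (potential k a' + (2 ^ k * mono a' c)%:Z))%R.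
Proof.
move=> lP a'; rewrite gainE /potential (energy_mono a' c).
rewrite mulnDr PoszD opprD addrA subrK mulrBr -!PoszM.
have p0 : p == 0 = false by apply/negbTE; rewrite -lt0n ltnW.
have aE v : a v * l v = p * a' v.
  by rewrite /a'; case: (lP v) => ->; rewrite ?eqxx ?p0 ?muln0 // mulnC.
congr (Posz _ - Posz _)%R.
  by under eq_bigr do rewrite aE; rewrite -big_distrr expnS /=; ring.
rewrite mulnCA; congr (_ * _); rewrite big_distrr; apply: eq_bigr => v _ /=.
rewrite big_distrr; apply: eq_bigr => u _ /=; rewrite /a'.
case: (lP v) => ->; case: (lP u) => ->;
  by rewrite ?eqxx ?p0 ?mul0n ?muln0 ?minn0 ?min0n ?muln0 ?mulnn.
Qed.

(** Evaluate [gain] before and after the turns by [gain1] and [gainp]. The monochromatic energy,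
    missing from [gain], costs at most [2 ^ k] times the energy, which turns [2 ^ k] into
    [2 ^ k.+1]. *)
Lemma stageP k (s : G -> node) :
  (forall v, act (s v) < 2 ^ b) -> (forall v, lab (s v) < 2 ^ b) ->
  (forall v, color (s v) = idn (s v)) -> (forall v, idn (s v) < 2 ^ L) ->
  injective (idn \o s) ->
  exists (a l : G -> nat),
    [/\ forall v, exec N b (stage p L k) s v =
          Node (wt (s v)) (a v) (idn (s v)) (l v) (idn (s v)) (hist (s v)),
        forall v, l v < 2 ^ b,
        forall v, a v = 0 \/ a v = act (s v)
      & (potential k.+1 (act \o s) <= (p ^ 2)%:Z * potential k a)%R].
Proof.
move=> sa sl sc si s_inj.
rewrite /stage !exec_cat.
have b1 : 1 < 2 ^ b := ltn_trans p1 pb.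
have fit v : fits b (s v).
  by split=> //; rewrite sc; apply: leq_trans (si v) _; rewrite leq_exp2l.
set s1 := step N b (r_recolor p L) s.
have sL v : color (s v) < 2 ^ L by rewrite sc.
have [c1 m1] := @recolorP G N b p p1 L s fit L0 sL.
have fit1 v : fits b (s1 v).
  split; [exact: (sa v) | | exact: b1].
  by apply: leq_trans (c1 v) _; rewrite leq_exp2l.
set s2 := step N b (r_recolor p (2 * hbits p L)) s1.
have k20 : 0 < 2 * hbits p L by rewrite muln_gt0 hbits_gt0.
have [c2 m2] := @recolorP G N b p p1 _ s1 fit1 k20 c1.
have fit2 v : fits b (s2 v).
  split; [exact: (sa v) | | exact: b1].
  by apply: leq_trans (c2 v) _; rewrite leq_exp2l.
have -> : exec N b [:: r_recolor p L; r_recolor p (2 * hbits p L)] s = s2 by [].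
have [l [tE lP gle]] := @turnsP k s2 (2 ^ (2 * hbits p (2 * hbits p L))) fit2 (fun=> erefl).
have {}lP v : l v = 0 \/ l v = p by have [+ _] := lP v; apply; exact: c2.
pose a v := if l v == 0 then 0 else act (s v).
exists a, l; split=> [v|v|v|].
- by rewrite /exec /= -/(exec _ _ _ _) /step /r_keep tE.
- by case: (lP v) => ->; rewrite ?expn_gt0.
- by rewrite /a; case: ifP; auto.
move: gle; rewrite gain1 (gainp _ _ _ lP) -/a.
(* Distinct identifiers leave no monochromatic edge at the start. *)
have m0 : mono (act \o s) (color \o s) = 0.
  apply: big1 => v _; apply: big1 => u /andP[vu /eqP /=]; rewrite !sc => /s_inj uv.
  by move: vu; rewrite uv adj_irr.
(* Each of the two recolourings adds at most a [1 / (2 p^2)] share of the energy. *)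
have mE : p ^ 2 * mono (act \o s2) (color \o s2) <= energy (act \o s).
  move: m1 m2; rewrite m0 muln0 add0n -/s1 -/s2.
  rewrite (_ : act \o s2 = act \o s) // (_ : act \o s1 = act \o s) //.
  by rewrite -!mulnA; lia.
have ma : mono a (color \o s2) <= mono (act \o s2) (color \o s2).
  apply: leq_sum => v _; apply: leq_sum => u _; rewrite /a.
  by rewrite leq_min !geq_min; do 2!case: ifP => _ //=; rewrite ?leqnn ?orbT.
rewrite /potential (_ : act \o s2 = act \o s) //.
move: mE ma; rewrite (_ : act \o s2 = act \o s) //.
set E := energy (act \o s); set M := mono _ _; set M' := mono _ _.
rewrite [2 ^ k.+1]expnSr; set K := 2 ^ k => ME M'M.
have : p ^ 2 * (K * M') <= K * E.
  rewrite mulnCA leq_mul2l; apply/orP; right; apply: leq_trans ME.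
  by rewrite leq_mul2l M'M orbT.
rewrite mulrDr -PoszM (_ : K * 2 * E = K * E + K * E); last by rewrite mulnAC muln2 addnn.
set T := (_ * (_ - _))%R; lia.
Qed.
End Stage.

(** * A phase and the local-ratio recursion *)

Section Phase.
Variables (G : sgraph) (N : network G) (b p L : nat).
Hypotheses (p1 : 1 < p) (pb : p < 2 ^ b) (L0 : 0 < L) (Lb : L <= b).
Hypotheses (L1b : 2 * hbits p L <= b) (L2b : 2 * hbits p (2 * hbits p L) <= b).

Lemma stagesP S (s : G -> node) :
  (forall v, act (s v) < 2 ^ b) -> (forall v, lab (s v) < 2 ^ b) ->
  (forall v, color (s v) = idn (s v)) -> (forall v, idn (s v) < 2 ^ L) ->
  injective (idn \o s) ->
  exists (a l : G -> nat),
    [/\ forall v, exec N b (stages p L S) s v =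
          Node (wt (s v)) (a v) (idn (s v)) (l v) (idn (s v)) (hist (s v)),
        forall v, l v < 2 ^ b,
        forall v, a v = 0 \/ a v = act (s v)
      & (potential p S (act \o s) <= (p ^ (2 * S))%:Z * potential p 0 a)%R].
Proof.
elim: S s => [|S IH] s sa sl sc si s_inj.
  exists (act \o s), (lab \o s); split=> //= [v|v|].
  - by case: (s v) (sc v) => ? ? ? ? ? ? /= ->.
  - by right.
  - by rewrite mul1r.
rewrite /= exec_cat.
have [a [l [tE lb aP le1]]] := stageP N p1 pb L0 Lb L1b L2b S sa sl sc si s_inj.
set t := exec _ _ _ _ in tE *.
have ab v : a v <= act (s v) by case: (aP v) => ->.
have [||||| a' [l' [tE' l'b a'P le2]]] := IH t.
- by move=> v; rewrite tE /=; apply: leq_ltn_trans (sa v).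
- by move=> v; rewrite tE /=; auto.
- by move=> v; rewrite tE /=; auto.
- by move=> v; rewrite tE /=; auto.
- by move=> u v /=; rewrite !tE /=; exact: s_inj.
exists a', l'; split=> // [v|v|].
- by rewrite tE' tE.
- by case: (a'P v) => ->; rewrite ?tE /=; [left | exact: aP].
have {}le2 : (potential p S a <= (p ^ (2 * S))%:Z * potential p 0 a')%R.
  by rewrite (_ : a = act \o t) //; apply: funext => v /=; rewrite tE.
apply: le_trans le1 _.
rewrite mulnS expnD PoszM -mulrA; apply: ler_wpM2l => //.
Qed.

(** The injective tie-break gives each edge exactly one loser, and a beaten [v] loses [a v], the
    minimum over an edge that it loses. Summing over edges once costs half the energy. *)
Lemma selectP (a c : G -> nat) : injective c ->
  let beats u v := (a v < a u) || (a v == a u) && (c v < c u) in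
  let a' v := if [exists u, adj v u && beats u v] then 0 else a v in
  (forall u v, adj u v -> a' u = 0 \/ a' v = 0) /\
  2 * \sum_v a v <= 2 * \sum_v a' v + energy a.
Proof.
move=> c_inj beats a'; split=> [u v uv|].
  have [uv'|vu'] : beats u v \/ beats v u.
    rewrite /beats; case: (ltngtP (a u) (a v)) => _; auto; rewrite /=.
    by case: (ltngtP (c u) (c v)) => [||/c_inj e]; auto; move: uv; rewrite e adj_irr.
  - right; rewrite /a'; case: existsP => // -[]; exists u.
    by rewrite adj_sym uv.
  - by left; rewrite /a'; case: existsP => // -[]; exists v; rewrite uv.
have beats_anti u v : beats u v -> ~~ beats v u.
  by rewrite /beats; case: (ltngtP (a u) (a v)) => //= _; rewrite -leqNgt => /ltnW.
pose lost := \sum_(v : G) \sum_(u | adj v u && beats u v) minn (a u) (a v).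
have le_lost : \sum_v a v <= \sum_v a' v + lost.
  rewrite -big_split; apply: leq_sum => v _ /=; rewrite /a'.
  case: existsP => [[u vu]|_]; last by rewrite leq_addr.
  rewrite (bigD1 u vu) /= add0n; apply: leq_trans (leq_addr _ _).
  have /andP[_] := vu; rewrite leq_min leqnn andbT /beats.
  by case/orP => [/ltnW //|/andP[/eqP-> _]].
(* Charging each edge to its winner instead gives the same sum; both copies together fit into the
   energy. *)
have lostC : lost = \sum_(v : G) \sum_(u | adj v u && beats v u) minn (a u) (a v).
  rewrite /lost; under eq_bigr do rewrite big_mkcond; rewrite exchange_big /=.
  under [RHS]eq_bigr do rewrite big_mkcond.
  by apply: eq_bigr => v _; apply: eq_bigr => u _; rewrite adj_sym minnC.
suff : lost + lost <= energy a by lia.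
rewrite [X in _ + X <= _]lostC -big_split; apply: leq_sum => v _ /=.
rewrite !(big_mkcondr _ _ (adj v)) -big_split /=; apply: leq_sum => u _.
case: ifP => [uv|_]; last by case: ifP.
by rewrite (negPf (beats_anti _ _ uv)) addn0.
Qed.

(** With [W] the total weight, the arboricity bound and the hypothesis on [p] give
    [2 ^ S * energy <= p ^ S * W], so the initial potential is at least [p ^ S * W]; the final one
    is at most twice the selected weight. *)
Lemma phaseP S (s : G -> node) :
  2 ^ S.+1 * arboricity G <= p ^ S ->
  (forall v, wt (s v) < 2 ^ b) -> (forall v, idn (s v) < 2 ^ L) ->
  injective (idn \o s) ->
  exists (a l : G -> nat),
    [/\ forall v, exec N b (phase p L S) s v =
          Node (wt (s v) - (a v + \sum_(u | adj v u) a u)) (a v) (idn (s v)) (l v)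
               (idn (s v)) ((0 < a v) :: hist (s v)),
        forall v, l v < 2 ^ b,
        forall v, a v = 0 \/ a v = wt (s v),
        forall u v, adj u v -> a u = 0 \/ a v = 0
      & \sum_v wt (s v) <= 2 * p ^ S * \sum_v a v].
Proof.
move=> pS sw si s_inj; rewrite /phase -cat1s !exec_cat.
set s0 := exec N b [:: r_start] s.
have [||||| a [l [tE lb aP le1]]] := stagesP S (s := s0) => //.
  by move=> v; rewrite expn_gt0.
set t := exec N b (stages p L S) s0 in tE *.
have fit v : fits b (t v).
  rewrite tE; split=> //=; first by apply: leq_ltn_trans (sw v); case: (aP v) => ->.
  by apply: leq_trans (si v) _; rewrite leq_exp2l.
pose a' v := if [exists u, adj v u && ((a v < a u) || (a v == a u) && (idn (s v) < idn (s u)))]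
  then 0 else a v.
have [ind sel] : (forall u v, adj u v -> a' u = 0 \/ a' v = 0) /\
    2 * \sum_v a v <= 2 * \sum_v a' v + energy a := @selectP a (idn \o s) s_inj.
set t' := step N b r_select t.
have tE' v : t' v = Node (wt (s v)) (a' v) (idn (s v)) (l v) (idn (s v)) (hist (s v)).
  rewrite /t' stepE // /r_select has_view tE /=; congr Node.
  by rewrite /a'; congr (if _ then _ else _); apply: eq_existsb => u; rewrite tE.
have a'P v : a' v = 0 \/ a' v = wt (s v).
  by rewrite /a'; case: ifP; auto.
have fit' v : fits b (t' v).
  rewrite tE'; have [_ fc fl] := fit v; rewrite tE in fc fl; split=> //=.
  by apply: leq_ltn_trans (sw v); case: (a'P v) => ->.
exists a', l; split=> // [v|].
  rewrite /exec /= -/t' stepE // /r_reduce sum_view.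
  under eq_bigr do rewrite tE'; under eq_bigl do rewrite andbT.
  by rewrite tE'.
have W : (act \o s0) = (wt \o s) by [].
have := arboricity_sum_minn (wt \o s); rewrite -/(energy (wt \o s)) => /= eW.
move: le1; rewrite W /potential expn0 expn0 muln1 mul1n.
set E := energy (wt \o s) in eW *; set Ws := \sum_v (wt \o s) v.
rewrite -/Ws in eW *.
set A := \sum_v a v; set A' := \sum_v a' v in sel *; set Ea := energy a in sel *.
rewrite (_ : p ^ (2 * S) = p ^ S * p ^ S); last by rewrite mul2n -addnn expnD.
move: pS; rewrite expnS; set P := p ^ S; set Q := 2 ^ S => pS le1.
have P0 : 0 < P by rewrite expn_gt0 ltnW.
have QE : Q * E <= P * Ws.
  apply: leq_trans (_ : Q * (2 * arboricity G * Ws) <= _).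
    by rewrite leq_mul2l eW orbT.
  by rewrite !mulnA leq_mul2r (mulnC Q 2) pS orbT.
have PA : ((P * P)%:Z * ((2 * A)%:Z - Ea%:Z) <= (P * P * (2 * A'))%:Z)%R.
  by rewrite [leRHS]PoszM; apply: ler_wpM2l => //; lia.
have : P * Ws <= P * P * (2 * A') by lia.
by rewrite -mulnA leq_pmul2l // mulnCA mulnA.
Qed.
End Phase.

(** * Local ratio: one phase and its unwinding *)

Section LocalRatio.
Variables (G : sgraph) (w a w' : G -> nat) (X' : {set G}).
Hypotheses (aw : forall v, a v = 0 \/ a v = w v)
  (a_ind : forall u v, adj u v -> a u = 0 \/ a v = 0)
  (w'E : forall v, w' v = w v - (a v + \sum_(u | adj v u) a u))
  (X'_ind : independent X') (X'_gt0 : forall v, v \in X' -> 0 < w' v).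

Definition extension : {set G} :=
  X' :|: [set v | (0 < a v) && ~~ [exists u, adj v u && (u \in X')]].

Lemma act_notin v : v \in X' -> a v = 0.
Proof. by move=> /X'_gt0; rewrite w'E; case: (aw v) => // ->; rewrite subnDA subnn. Qed.

Lemma extension_gt0 v : v \in extension -> 0 < w v.
Proof.
rewrite !inE => /orP[/X'_gt0|/andP[+ _]]; first by rewrite w'E; case: (w v).
by case: (aw v) => ->.
Qed.

Lemma independentP (I : {set G}) :
  reflect (forall u v, u \in I -> v \in I -> ~~ adj u v) (independent I).
Proof.
apply: (iffP forall_inP) => [H u v uI|H u uI].
  by have /forall_inP := H u uI; apply.
by apply/forall_inP => v; exact: H.
Qed.

Lemma extension_independent : independent extension.
Proof.
apply/independentP => u v; rewrite !inE.
case/orP => [uX|/andP[au nu]]; case/orP => [vX|/andP[av nv]].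
- exact: (independentP _ X'_ind).
- by apply: contra nv => uv; apply/existsP; exists u; rewrite adj_sym uv.
- by apply: contra nu => uv; apply/existsP; exists v; rewrite uv.
- by apply/negP => /a_ind[] E; [move: au | move: av]; rewrite E.
Qed.

(** Each selected [u] is paid for: either it joins the extension with weight [a u], or a neighbour
    in [X'] lost [a u] in this phase and regains it. *)
Lemma extension_weight :
  \sum_(v in X') w' v + \sum_v a v <= \sum_(v in extension) w v.
Proof.
pose Y := [set v | (0 < a v) && ~~ [exists u, adj v u && (u \in X')]].
rewrite (_ : \sum_(v in extension) w v = \sum_(v in X') w v + \sum_(v in Y) w v); last first.
  rewrite -bigU /=; first by apply: eq_bigl => v; rewrite !inE.
  by rewrite disjoint_subset; apply/subsetP => v /act_notin a0; rewrite !inE a0.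
(* On [X'] the residual weight is positive, so the truncated subtraction is exact. *)
have -> : \sum_(v in X') w v =
    \sum_(v in X') w' v + \sum_(v in X') \sum_(u | adj v u) a u.
  rewrite -big_split; apply: eq_bigr => v vX /=.
  by have := X'_gt0 vX; rewrite w'E (act_notin vX) add0n subn_gt0 => /ltnW/subnK.
rewrite -addnA leq_add2l.
have -> : \sum_(v in X') \sum_(u | adj v u) a u = \sum_u \sum_(v in X' | adj u v) a u.
  under eq_bigr do rewrite big_mkcond; rewrite exchange_big /=.
  apply: eq_bigr => u _; rewrite [RHS]big_mkcondr.
  by apply: eq_bigr => v _; rewrite adj_sym.
rewrite [\sum_(v in Y) _]big_mkcond -big_split; apply: leq_sum => u _ /=.
have [au|] := posnP (a u); first by rewrite au.
move=> au; rewrite inE au /=; case: existsP => [[v /andP[uv vX]]|_] /=.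
  by rewrite addn0 (bigD1 v) ?vX //= leq_addr.
by case: (aw u) au => [->|<-] // _; rewrite leq_addl.
Qed.

(** The value [a u] is subtracted from at most [maxdeg G] members of [I]: only from [u] itself if
    [u] is in [I], otherwise from neighbours of [u]. *)
Lemma local_ratio_bound (I : {set G}) : independent I -> 0 < maxdeg G ->
  \sum_(v in I) w v <= \sum_(v in I) w' v + maxdeg G * \sum_v a v.
Proof.
move=> /independentP I_ind D0.
apply: leq_trans (_ : \sum_(v in I) w' v +
    \sum_(v in I) (a v + \sum_(u | adj v u) a u) <= _).
  by rewrite -big_split; apply: leq_sum => v _ /=; rewrite w'E addnC -leq_subLR.
rewrite leq_add2l big_split /=.
have -> : \sum_(v in I) \sum_(u | adj v u) a u = \sum_u \sum_(v in I | adj u v) a u.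
  under eq_bigr do rewrite big_mkcond; rewrite exchange_big /=.
  apply: eq_bigr => u _; rewrite [RHS]big_mkcondr.
  by apply: eq_bigr => v _; rewrite adj_sym.
rewrite big_mkcond -big_split big_distrr; apply: leq_sum => u _ /=.
case: ifP => [uI|_].
  rewrite big_pred0 ?addn0 ?leq_pmull // => v.
  by apply/andP => -[vI uv]; have := I_ind _ _ uI vI; rewrite uv.
rewrite add0n sum_nat_const leq_mul2r; apply/orP; right.
apply: leq_trans (degree_le_maxdeg u); apply: subset_leq_card.
by apply/subsetP => v /andP[_ uv]; rewrite inE.
Qed.
End LocalRatio.

(** * Geometric convergence over the phases *)

Section Program.
Variables (R : realType) (G : sgraph) (N : network G) (b p L S K : nat).
Hypotheses (p1 : 1 < p) (pb : p < 2 ^ b) (L0 : 0 < L) (Lb : L <= b).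
Hypotheses (L1b : 2 * hbits p L <= b) (L2b : 2 * hbits p (2 * hbits p L) <= b).
Hypotheses (pS : 2 ^ S.+1 * arboricity G <= p ^ S) (D0 : 0 < maxdeg G).
Hypotheses (K0 : 0 < K) (KD : 2 * p ^ S <= K * maxdeg G).

(* The last bound is stated for all g below the weight of I because the
   induction applies it to the gap left after the first phase. *)
Lemma programP M (s : G -> node) :
  (forall v, fits b (s v)) -> (forall v, wt (s v) < 2 ^ b) ->
  (forall v, idn (s v) < 2 ^ L) -> injective (idn \o s) ->
  let s' := exec N b (program p L S M) s in
  exists X : {set G},
    [/\ [/\ forall v, fits b (s' v), forall v, wt (s' v) < 2 ^ b & forall v, hist (s' v) = hist (s v)],
        forall v, lab (s' v) = (v \in X),
        independent X, forall v, v \in X -> 0 < wt (s v)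
      & forall (I : {set G}) (g : R), independent I ->
          (g <= (\sum_(v in I) wt (s v))%:R ->
           g * (1 - (1 - K%:R^-1) ^+ M) <= (maxdeg G * \sum_(v in X) wt (s v))%:R)%R].
Proof.
elim: M s => [|M IH] s fit sw si s_inj s'.
  exists set0; split=> [|v|||].
  - split=> // v; have [fa fc _] := fit v; split=> //=; exact: expn_gt0.
  - by rewrite inE.
  - by apply/independentP => u v; rewrite inE.
  - by move=> v; rewrite inE.
  - by move=> I g _ _; rewrite expr0 subrr mulr0 ler0n.
have [a [l [tE lb aw a_ind W]]] := phaseP N p1 pb L0 Lb L1b L2b pS sw si s_inj.
set t := exec N b (phase p L S) s in tE.
pose w' v := wt (s v) - (a v + \sum_(u | adj v u) a u).
have ab v : a v < 2 ^ b by apply: leq_ltn_trans (sw v); case: (aw v) => ->.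
have [|||| X' [[fit' sw' hist'] labX' X'_ind X'_gt0 gX']] := IH t.
- move=> v; rewrite tE; split=> //=.
  by apply: leq_trans (si v) _; rewrite leq_exp2l.
- by move=> v; rewrite tE /=; apply: leq_ltn_trans (sw v); rewrite leq_subr.
- by move=> v; rewrite tE /=; auto.
- by move=> u v /=; rewrite !tE /=; exact: s_inj.
have {}X'_gt0 v : v \in X' -> 0 < w' v by move=> /X'_gt0; rewrite tE.
pose X := extension a X'.
have w'E v : w' v = wt (s v) - (a v + \sum_(u | adj v u) a u) by [].
have s'E : s' = step N b r_back (exec N b (program p L S M) t).
  rewrite /s' -[program _ _ _ _]/(phase p L S ++ program p L S M ++ [:: r_back]).
  by rewrite !exec_cat.
set t' := exec _ _ _ _ in fit' sw' hist' labX' s'E.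
have hist_t' v : hist (t' v) = (0 < a v) :: hist (s v) by rewrite hist' tE.
have labX v : lab (s' v) = (v \in X).
  rewrite s'E stepE // /r_back has_view /= labX' hist_t' !inE /=.
  congr nat_of_bool; congr (_ || _ && ~~ _); first by case: (v \in X').
  by apply: eq_existsb => u; rewrite labX'; case: (u \in X').
exists X; split=> //.
- split=> v; rewrite s'E; last by rewrite stepE //= hist_t'.
    have [fa fc _] := fit' v; split=> //=.
    by rewrite -/(lab _) -[X in X < _]/(lab (step N b r_back t' v)) -s'E labX;
      apply: leq_ltn_trans (leq_b1 _) (ltn_trans p1 pb).
  exact: sw'.
- exact: (extension_independent a_ind X'_ind).
- exact: (extension_gt0 aw w'E X'_gt0).
move=> I g I_ind gI.
have := extension_weight aw w'E X'_gt0; rewrite -/X => wX.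
have wI := local_ratio_bound w'E I_ind D0.
set A := \sum_v a v in W wX wI; set D := maxdeg G in wI *.
have := gX' I (g - (D * A)%:R)%R I_ind.
have wtE (J : {set G}) : \sum_(v in J) wt (t v) = \sum_(v in J) w' v.
  by apply: eq_bigr => v _; rewrite tE.
rewrite !wtE; set gw := (g - _)%R => H.
have {}H : (gw * (1 - (1 - K%:R^-1) ^+ M) <= (D * \sum_(v in X') w' v)%:R)%R.
  by apply: H; rewrite lerBlDr -natrD; apply: le_trans gI _; rewrite ler_nat.
apply: le_trans (_ : (gw * (1 - (1 - K%:R^-1) ^+ M) + (D * A)%:R <= _))%R; last first.
  apply: le_trans (lerD H (lexx _)) _; rewrite -natrD ler_nat -mulnDr leq_mul2l wX.
  by rewrite orbT.
have KR : (0 < K%:R :> R)%R by rewrite ltr0n.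
(* One phase closes a [1 / K] share of the gap: [g] is at most the total weight, hence at most
   [2 * p ^ S * A <= K * D * A]. *)
have gK : (g * K%:R^-1 <= (D * A)%:R)%R.
  rewrite ler_pdivrMr //; apply: le_trans gI _; rewrite -natrM ler_nat.
  apply: leq_trans (_ : \sum_v wt (s v) <= _).
    by rewrite [leqLHS]big_mkcond; apply: leq_sum => v _; case: ifP.
  apply: leq_trans W _; rewrite -/A [leqRHS]mulnAC leq_mul2r.
  by rewrite [D * K]mulnC KD orbT.
have : (0 <= (1 - K%:R^-1) ^+ M :> R)%R.
  by rewrite exprn_ge0 // subr_ge0 invf_le1 // ler1n.
rewrite exprS /gw; set r := ((_ ^+ M) : R)%R; set T := ((D * A)%:R : R)%R.
(* The two sides differ by [r * (T - g * k)]. *)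
move: gK; rewrite -/T; set k := (K%:R^-1 : R)%R; nra.
Qed.
End Program.

(** * Round count and message size *)

Section Compile.
Variables (I : Type) (width : I -> nat) (prog : I -> seq rule) (ini : I -> node).

Definition compile : algorithm I bool :=
  @Algorithm I bool (nat * seq rule * node)
    (fun i => (width i, prog i, ini i))
    (fun s _ => pack s.1.1 s.2)
    (fun s ms => if s.1.2 is r :: P then (s.1.1, P, r s.2 [seq unpack s.1.1 m | m <- ms]) else s)
    (fun s => if s.1.2 is [::] then Some (lab s.2 == 1) else None).

Variables (G : sgraph) (N : network G) (x : G -> I) (b : nat) (P : seq rule).
Hypotheses (xb : forall v, width (x v) = b) (xP : forall v, prog (x v) = P).

Lemma run_width t v : (run N compile x t v).1.1 = b.
Proof.
elim: t v => [|t IH] v /=; first exact: xb.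
by rewrite /round -/(run N compile x t) /=; have := IH v;
  case: (run N compile x t v) => [[b' [|r P']] y].
Qed.

Lemma compile_bandwidth : bandwidth_le N compile x (3 * b).
Proof.
move=> t u v _; rewrite /message; case: output => //=.
by rewrite size_pack run_width.
Qed.

(** All nodes hold the same list of rules, so they halt together and no message is silenced
    early. *)
Lemma compile_run t v : t <= size P ->
  run N compile x t v = (b, drop t P, exec N b (take t P) (ini \o x) v).
Proof.
elim: t v => [|t IH] v tP; first by rewrite /= drop0 take0 xb xP.
have r0 : rule := fun y _ => y.
have IH' u := IH u (ltnW tP); rewrite /= /round -/(run N compile x t) IH'.
rewrite (drop_nth r0 tP) /=; congr (_, _).
rewrite (take_nth r0 tP) -cats1 exec_cat /= /step; congr (nth r0 P t _ _).
rewrite -map_comp; apply: eq_map => u /=.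
by rewrite /message IH' (drop_nth r0 tP).
Qed.

Lemma compile_outputs :
  outputs_after N compile x (size P) (fun v => lab (exec N b P (ini \o x) v) == 1).
Proof. by move=> v; rewrite compile_run // drop_size take_size. Qed.
End Compile.

(** The 3 counts two recolourings and [r_keep], the 4 counts [r_start], [r_select], [r_reduce] and
    [r_back], and the last round is [r_out]. *)
Lemma size_program p L S M :
  size (program p L S M) =
  (M * (S * (2 ^ (2 * hbits p (2 * hbits p L)) + 3) + 4)).+1.
Proof.
have stagesE T : size (stages p L T) = T * (2 ^ (2 * hbits p (2 * hbits p L)) + 3).
  elim: T => // T IH; rewrite -[stages _ _ _]/(stage p L T ++ stages p L T).
  by rewrite size_cat IH /stage !size_cat size_map size_iota mulSn /=; lia.
elim: M => // M IH; rewrite -[program _ _ _ _]/(phase p L S ++ program p L S M ++ [:: r_back]).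
by rewrite /phase !size_cat IH /= size_cat stagesE mulSn /=; lia.
Qed.

(** * Numerical bounds on the sampling base, colours and phases *)

Section SamplingBase.
Variables S : nat.
Hypothesis S0 : 0 < S.

Lemma base_ex A : exists p, 2 ^ S.+1 * A <= p ^ S.
Proof.
exists (2 ^ S.+1 * A); case: (2 ^ S.+1 * A) => // x.
by rewrite -[leqLHS]expn1 leq_pexp2l.
Qed.

Definition base A := ex_minn (base_ex A).

Lemma baseP A : 2 ^ S.+1 * A <= base A ^ S.
Proof. by rewrite /base; case: ex_minnP. Qed.

Lemma base_gt1 A : 0 < A -> 1 < base A.
Proof.
move=> A0; have := baseP A; rewrite !ltnNge; apply: contraL => b1.
rewrite -ltnNge; apply: leq_ltn_trans (_ : 1 ^ S < _); first by rewrite leq_exp2r.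
by rewrite exp1n; apply: leq_trans (leq_pmulr _ A0); rewrite -[1]/(2 ^ 0) ltn_exp2l.
Qed.

(** Minimality bounds [p.-1 ^ S], and [p <= 2 * p.-1] because [p] exceeds 1. *)
Lemma base_upper A : 0 < A -> base A ^ S <= 2 ^ (2 * S).+1 * A.
Proof.
move=> A0; have p1 := base_gt1 A0; rewrite /base in p1 *.
case: ex_minnP p1 => p _ pmin p1.
have lt : p.-1 ^ S < 2 ^ S.+1 * A.
  by rewrite ltnNge; apply/negP => /pmin; rewrite leqNgt prednK ?leqnn // ltnW.
apply: leq_trans (_ : (2 * p.-1) ^ S <= _); first by rewrite leq_exp2r //; lia.
rewrite expnMn; apply: leq_trans (_ : 2 ^ S * (2 ^ S.+1 * A) <= _).
  by rewrite leq_mul2l ltnW ?orbT.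
by rewrite mulnA -expnD leq_mul2r; apply/orP; right; rewrite leq_exp2l //; lia.
Qed.
End SamplingBase.

Lemma hbits_upper p k : 1 < p -> 0 < k -> 2 ^ hbits p k <= 4 * p ^ 2 * k.
Proof.
move=> p1 k0; rewrite /hbits; set X := 2 * p ^ 2 * k.
have X1 : 1 < X by rewrite /X; nia.
have := up_log_gtn (isT : 1 < 2) X1.
have : 0 < up_log 2 X by rewrite up_log_gt0.
by case: up_log => // h _ /=; rewrite expnS /X; lia.
Qed.

(** This crude form bounds message widths; the round count uses [hbits_upper]. *)
Lemma hbits_linear p k e : 1 < p -> 0 < k -> p <= 2 ^ e -> hbits p k <= 2 + 2 * e + k.
Proof.
move=> p1 k0 pe; rewrite -(@leq_exp2l 2) //; apply: leq_trans (hbits_upper p1 k0) _.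
rewrite !expnD leq_mul //; last exact/ltnW/ltn_expl.
by rewrite leq_mul // expn0 muln1 mulnn leq_exp2r.
Qed.

Lemma sqr_le_exp2 j : j ^ 2 <= 2 * 2 ^ j.
Proof.
elim: j => [|[|[|[|j]]] IH] //.
by move: IH; rewrite [2 ^ j.+4]expnS; set X := 2 ^ _; nia.
Qed.

(** The second recolouring leaves at most [64 * p ^ 4 * j ^ 2] colours, where [j] is logarithmic;
    [j ^ 2 <= 2 * 2 ^ j <= 8 * p ^ 2 * L] absorbs the square. *)
Lemma turns_upper p L : 1 < p -> 0 < L ->
  2 ^ (2 * hbits p (2 * hbits p L)) <= 512 * p ^ 6 * L.
Proof.
move=> p1 L0; set j := hbits p L; have j0 : 0 < 2 * j by rewrite muln_gt0 hbits_gt0.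
have h2 := hbits_upper p1 j0; have h1 := hbits_upper p1 L0; rewrite -/j in h1.
have j2 := leq_trans (sqr_le_exp2 j) (leq_mul (leqnn 2) h1).
rewrite mulnC expnM; apply: leq_trans (_ : (4 * p ^ 2 * (2 * j)) ^ 2 <= _).
  by rewrite leq_exp2r.
rewrite (_ : _ ^ 2 = 64 * p ^ 4 * j ^ 2); last by ring.
rewrite (_ : 512 * p ^ 6 * L = 64 * p ^ 4 * (2 * (4 * p ^ 2 * L))); last by ring.
by rewrite leq_mul2l j2 orbT.
Qed.

Section Bounds.
Variable R : realType.
Local Open Scope ring_scope.

Lemma up_log_le_ln n : (1 < n)%N -> ((up_log 2 n)%:R <= 2 / ln 2 * ln n%:R :> R).
Proof.
move=> n1; have ln2 : 0 < ln 2 :> R by rewrite ln_gt0 // ltr1n.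
have le_ln k : (2 ^ k <= n)%N -> k%:R * ln 2 <= ln n%:R :> R.
  move=> kn; rewrite mulr_natl -lnXn // -natrX ler_ln ?posrE ?ltr0n ?expn_gt0 //.
    by rewrite ler_nat.
  by rewrite ltnW.
rewrite mulrAC ler_pdivlMr //.
have := up_log_gtn (isT : (1 < 2)%N) n1; have : (0 < up_log 2 n)%N by rewrite up_log_gt0.
case: up_log => // u _ /= /ltnW/le_ln un.
have := le_ln 1%N n1; rewrite mul1r -natr1 mulrDl mul1r; lra.
Qed.

(** From [p ^ S <= 8 ^ S * A] follows that [p] is at most 8 times the [S]-th root of [A], and
    [1 / S <= tau / 6]. *)
Lemma base_le_powR (tau : R) S A (S0 : (0 < S)%N) : 0 < tau -> 6 <= tau * S%:R ->
  (0 < A)%N -> (base S0 A ^ 6)%N%:R <= 8 ^+ 6 * A%:R `^ tau :> R.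
Proof.
move=> tau0 tauS A0; set p := base S0 A.
pose y : R := A%:R `^ (tau / 6).
have A1 : 1 <= A%:R :> R by rewrite ler1n.
have yS : A%:R <= y ^+ S.
  rewrite -powR_mulrn ?powR_ge0 // -powRrM -[leLHS]powRr1 ?ler0n //.
  by apply: ler_powR => //; lra.
have p8 : p%:R <= 8 * y.
  rewrite -(@ler_pXn2r _ S) ?nnegrE ?mulr_ge0 ?powR_ge0 ?ler0n //.
  apply: le_trans (_ : (8 ^ S * A)%N%:R <= _).
    rewrite -natrX ler_nat; apply: leq_trans (base_upper S0 A0) _.
    by rewrite leq_mul2r (_ : 8 = 2 ^ 3)%N // -expnM leq_exp2l //; lia.
  by rewrite natrM natrX exprMn ler_wpM2l // exprn_ge0.
rewrite natrX; apply: le_trans (_ : (8 * y) ^+ 6 <= _).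
  by rewrite lerXn2r ?nnegrE ?mulr_ge0 ?powR_ge0 ?ler0n.
by rewrite exprMn -[y ^+ 6]powR_mulrn ?powR_ge0 // -powRrM divfK // pnatr_eq0.
Qed.

(** By [1 - x <= exp (- x)] the remaining gap is at most [E ^- 2] with [E = expR m]. The maximum
    with 1 gives [E >= 2], the logarithm gives [E * eps >= 1], and so
    [(1 + eps) * E ^- 2 <= eps]. *)
Lemma contraction_bound (eps : R) K M : 0 < eps -> (0 < K)%N ->
  2 * K%:R * Num.max 1 (ln (1 / eps)) <= M%:R ->
  1 <= (1 + eps) * (1 - (1 - K%:R^-1) ^+ M).
Proof.
move=> eps0 K0 KM; have KR : 0 < K%:R :> R by rewrite ltr0n.
set m := Num.max _ _ in KM; pose E := expR m.
have E2 : 2 <= E.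
  apply: le_trans (expR_ge1Dx _); rewrite -[2]/(1 + 1) lerD2l.
  by rewrite /m le_max lexx.
have Eeps : 1 <= E * eps.
  rewrite -ler_pdivrMr // -[leLHS]lnK ?posrE ?divr_gt0 // ler_expR.
  by rewrite /m le_max lexx orbT.
have rho : (1 - K%:R^-1) ^+ M <= (E ^+ 2)^-1 :> R.
  apply: le_trans (_ : expR (- K%:R^-1) ^+ M <= _).
    rewrite lerXn2r ?nnegrE ?expR_ge0 ?subr_ge0 ?invf_le1 ?ler1n //.
    exact: expR_ge1Dx.
  rewrite -!expRM_natl -expRN ler_expR mulrN lerN2.
  by rewrite ler_pdivlMr // mulrAC.
have E0 : 0 < E ^+ 2 by rewrite exprn_gt0 ?expR_gt0.
have : (E ^+ 2)^-1 * (1 + eps) <= eps.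
  rewrite mulrC ler_pdivrMr //; nra.
nra.
Qed.
End Bounds.

Section Network.
Local Open Scope ring_scope.

(** The program depends only on [n] and the arboricity, so all nodes agree on it; [c.+1] keeps the
    identifier width positive even for [c = 0]. *)
Definition mwis_program (R : realType) (S c M : nat) (S0 : (0 < S)%N) (i : local_input R) :
    seq rule :=
  program (base S0 (in_arboricity i)) (c.+1 * up_log 2 (in_size i)) S M.

Definition mwis_init (R : realType) (c : nat) (i : local_input R) : node :=
  Node (Num.truncn (in_weight i * 2 ^+ log_bits c (in_size i))) 0 0 0 (in_ident i) [::].

Definition mwis_width (R : realType) (B : nat) (i : local_input R) : nat :=
  log_bits B (in_size i).

Lemma truncn_fixed_point (R : realType) (b : nat) (x : R) :
  0 <= x -> fixed_point b x ->
  (Num.truncn (x * 2 ^+ b))%:R = x * 2 ^+ b /\ (Num.truncn (x * 2 ^+ b) < 2 ^ (b + b))%N.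
Proof.
move=> x0 [xint xb]; have tE : (Num.truncn (x * 2 ^+ b))%:R = x * 2 ^+ b.
  by apply: truncnK; rewrite natrEint xint mulr_ge0 // exprn_ge0.
split=> //; rewrite -(ltr_nat R) tE natrX exprD ltr_pM2r ?exprn_gt0 //.
by apply: le_lt_trans xb; exact: ler_norm.
Qed.

Lemma independent_OPT (R : realType) (G : sgraph) (w : G -> R) (q : R) (X : {set G}) :
  independent X -> 0 <= q * weight w X ->
  (forall I : {set G}, independent I -> weight w I <= q * weight w X) ->
  approximation w q X.
Proof.
move=> X_ind q0 qI; split=> //; rewrite /OPT.
by elim/big_ind : _ => // x y xq yq; rewrite ge_max xq.
Qed.

Lemma maxdeg_lt_card (G : sgraph) : (0 < maxdeg G -> maxdeg G < #|G|)%N.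
Proof.
move=> D0; rewrite -(prednK (_ : 0 < #|G|)%N); last first.
  by rewrite lt0n; apply: contraTneq D0 => G0; rewrite /maxdeg big_pred0 // => v;
    have := fintype0 v G0.
rewrite ltnS; apply/bigmax_leqP => v _; rewrite /degree.
rewrite -(cardC1 v); apply: subset_leq_card; apply/subsetP => u.
by rewrite !inE; apply: contraTneq => ->; rewrite adj_irr.
Qed.

End Network.

Local Open Scope ring_scope.

Theorem theorem4p8 (R : realType) (tau : R) (c : nat) (htau : 0 < tau) :
  exists (C : R) (B : nat), forall eps : R, 0 < eps ->
  exists A : algorithm (local_input R) bool,
  forall (G : sgraph) (N : network G) (w : G -> R),
    (0 < maxdeg G)%N ->
    (forall v, (ident N v < 2 ^ log_bits c #|G|)%N) ->
    (forall v, 0 <= w v) ->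
    (forall v, fixed_point (log_bits c #|G|) (w v)) ->
    bandwidth_le N A (congest_input N w) (log_bits B #|G|) /\
    exists (T : nat) (f : G -> bool),
      [/\ T%:R <= C * ((arboricity G)%:R `^ tau) * ln (#|G|%:R)
                    * Num.max 1 (ln (1 / eps)),
          outputs_after N A (congest_input N w) T f &
          approximation w ((maxdeg G)%:R * (1 + eps)) [set v | f v]].
Proof.
pose S := (Num.truncn (6 / tau)).+1; have S0 : (0 < S)%N by [].
have tauS : 6 <= tau * S%:R.
  by rewrite mulrC -ler_pdivrMr //; exact/ltW/truncnS_gt.
(* By [base_upper] and arboricity at most [maxdeg G], this [K] satisfies
   [2 * p ^ S <= K * maxdeg G]. *)
pose K := (2 ^ (2 * S).+2)%N; have K0 : (0 < K)%N by rewrite expn_gt0.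
(* In units of [up_log 2 n], [e] bounds the bits of [p], and [h1] and [h2] bound the two hash
   widths; [B] makes room for weights, labels, identifiers and both colourings. *)
pose e := (2 * S).+2.
pose h1 := (2 + 2 * e + c.+1)%N; pose h2 := (2 + 2 * e + 2 * h1)%N.
pose B := (2 * c + e.+1 + c.+1 + 2 * h1 + 2 * h2)%N.
exists ((9 * S * 512 * c.+1)%N%:R * 8 ^+ 6 * (2 / ln 2) * (2 * K%:R + 1)), (3 * B)%N.
move=> eps eps0.
set m := Num.max 1 (ln (1 / eps)).
have m1 : 1 <= m by rewrite /m le_max lexx.
pose M := (Num.truncn (2 * K%:R * m)).+1.
have Mlo : 2 * K%:R * m <= M%:R by exact/ltW/truncnS_gt.
have Mhi : M%:R <= (2 * K%:R + 1) * m.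
  rewrite /M -natr1 [leRHS]mulrDl mul1r; apply: lerD => //; rewrite truncn_le //.
  by rewrite !mulr_ge0 // (le_trans ler01).
exists (compile (@mwis_width R B) (mwis_program c M S0) (@mwis_init R c)).
move=> G N w D0 idb w0 wfix.
pose n := #|G|; pose u := up_log 2 n; pose L := (c.+1 * u)%N; pose b := log_bits B n.
pose A := arboricity G; pose p := base S0 A.
have n1 : (1 < n)%N by apply: leq_ltn_trans D0 (maxdeg_lt_card D0).
have u0 : (0 < u)%N by rewrite up_log_gt0.
have A0 : (0 < A)%N := arboricity_gt0 D0.
have p1 : (1 < p)%N := base_gt1 S0 A0.
have L0 : (0 < L)%N by rewrite muln_gt0.
have pe : (p <= 2 ^ (e * u))%N.
  apply: leq_trans (_ : p ^ S <= _)%N.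
    by rewrite -[leqLHS]expn1 leq_pexp2l // ltnW.
  apply: leq_trans (base_upper S0 A0) _; apply: leq_trans (_ : 2 ^ (2 * S).+1 * 2 ^ u <= _)%N.
    rewrite leq_mul2l; apply/orP; right; apply: leq_trans (arboricity_le_maxdeg G) _.
    by apply: leq_trans (ltnW (maxdeg_lt_card D0)) _; exact: up_logP.
  by rewrite -expnD leq_exp2l // [leqRHS]mulSn addnC leq_add2l leq_pmulr.
have hu k k' : (0 < k)%N -> (k <= k' * u)%N -> (hbits p k <= (2 + 2 * e + k') * u)%N.
  move=> k0 kk'; apply: leq_trans (hbits_linear p1 k0 pe) _.
  by rewrite !mulnDl -!mulnA; apply: leq_add kk'; apply: leq_add => //; exact: leq_pmulr.
have H1 : (hbits p L <= h1 * u)%N := hu _ _ L0 (leqnn _).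
have k20 : (0 < 2 * hbits p L)%N by rewrite muln_gt0 hbits_gt0.
have H2 : (hbits p (2 * hbits p L) <= h2 * u)%N.
  by apply: hu => //; rewrite -mulnA leq_mul2l H1 orbT.
have bE : b = (2 * c * u + e.+1 * u + L + 2 * (h1 * u) + 2 * (h2 * u))%N.
  by rewrite /b /log_bits /B /L -/u; ring.
have pb : (p < 2 ^ b)%N.
  apply: leq_ltn_trans pe _; rewrite ltn_exp2l // bE mulSn; lia.
have Lb : (L <= b)%N by rewrite bE; lia.
have L1b : (2 * hbits p L <= b)%N by rewrite bE; lia.
have L2b : (2 * hbits p (2 * hbits p L) <= b)%N by rewrite bE; lia.
pose om v := Num.truncn (w v * 2 ^+ log_bits c n).
have omP v := truncn_fixed_point (w0 v) (wfix v).
pose s0 : G -> node := @mwis_init R c \o congest_input N w.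
pose P := program p L S M.
pose f v := lab (exec N b P s0 v) == 1%N.
have KD : (2 * p ^ S <= K * maxdeg G)%N.
  apply: leq_trans (_ : 2 * (2 ^ (2 * S).+1 * A) <= _)%N.
    by rewrite leq_mul2l base_upper ?orbT.
  by rewrite mulnA -expnS leq_mul2l arboricity_le_maxdeg orbT.
have [||||X [_ labX X_ind _ gX]] :=
    @programP R G N b p L S K p1 pb L0 Lb L1b L2b (baseP S0 A) D0 K0 KD M s0.
- by move=> v; split; rewrite expn_gt0.
- move=> v /=; have [_ lt] := omP v; apply: leq_trans lt _.
  by rewrite leq_exp2l // bE /log_bits -/u; lia.
- move=> v /=; apply: leq_trans (idb v) _; rewrite leq_exp2l // /log_bits -/n -/u.
  by rewrite leq_mul2r leqnSn orbT.
- by move=> v v' /=; exact: ident_inj.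
have fX : [set v | f v] = X.
  by apply/setP => v; rewrite inE /f labX; case: (v \in X).
split.
  rewrite (_ : log_bits (3 * B) #|G| = 3 * b)%N; last by rewrite /b /log_bits mulnA.
  exact: compile_bandwidth.
exists (size P), f; split.
- rewrite size_program.
  set Q := (2 ^ (2 * hbits p (2 * hbits p L)))%N.
  have Q0 : (0 < Q)%N by rewrite expn_gt0.
  have QU : (Q <= 512 * p ^ 6 * L)%N := turns_upper p1 L0.
  (* As [S] and [Q] are at least 1, [S * (Q + 3) + 4 <= 8 * S * Q]; the ninth share pays for the
     final round. *)
  have T1 : ((M * (S * (Q + 3) + 4)).+1 <= 9 * S * Q * M)%N.
    apply: leq_trans (_ : 8 * (S * Q) * M + S * Q * M <= _)%N; last by lia.
    rewrite -addn1 leq_add ?muln_gt0 ?S0 ?Q0 // mulnC leq_mul2r; apply/orP; right.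
    by rewrite mulnDr; have := leq_pmulr S Q0; have := S0; clear; lia.
  apply: le_trans (_ : (9 * S * (512 * p ^ 6 * L) * M)%N%:R <= _).
    rewrite ler_nat; apply: leq_trans T1 _; rewrite leq_mul2r leq_mul2l QU.
    by rewrite !orbT.
  rewrite (_ : (9 * S * (512 * p ^ 6 * L) * M)%N%:R =
    (9 * S * 512 * c.+1)%N%:R * (p ^ 6)%N%:R * u%:R * M%:R :> R); last first.
    by rewrite /L !natrM; ring.
  have p6 := base_le_powR S0 htau tauS A0; rewrite -/p in p6.
  have uln := @up_log_le_ln R n n1.
  rewrite [leRHS](_ : _ = (9 * S * 512 * c.+1)%N%:R * (8 ^+ 6 * A%:R `^ tau) *
    (2 / ln 2 * ln n%:R) * ((2 * K%:R + 1) * m)); last by rewrite -/n -/A; ring.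
  by rewrite !ler_pM ?mulr_ge0 ?ler0n.
- exact: compile_outputs.
rewrite fX.
have wX0 (I : {set G}) : 0 <= weight w I by apply: sumr_ge0.
apply: independent_OPT => //; first by rewrite !mulr_ge0 ?ler0n // addr_ge0 // ltW.
move=> I I_ind.
have omE (J : {set G}) : (\sum_(v in J) wt (s0 v))%:R = weight w J * 2 ^+ log_bits c n :> R.
  by rewrite natr_sum /weight big_distrl; apply: eq_bigr => v _; case: (omP v).
(* Take [g] to be the full scaled weight of [I]; the common scaling factor then cancels. *)
have := gX I _ I_ind (lexx _); rewrite natrM !omE mulrAC mulrA.
rewrite ler_pM2r ?exprn_gt0 // => gI.
have := contraction_bound eps0 K0 Mlo; have := wX0 I.
move: gI; set r := _ ^+ M; set x := weight w I; set y := (maxdeg G)%:R * weight w X => xy x0 r1.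
apply: le_trans (_ : (1 + eps) * y <= _); last by rewrite /y mulrCA mulrA.
apply: le_trans (_ : (1 + eps) * (x * (1 - r)) <= _); last first.
  by rewrite ler_wpM2l // addr_ge0 // ltW.
by rewrite mulrCA ler_peMr.
Qed.
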